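(* There exists a function $f:(0,1]\to\mathbb{N}$ such that the following holds. Let $R$ be a finite ring and let $\varepsilon=\mathrm{cp}(R)$. Then there exists a Lie-ideal $D$ of the Lie ring $(R,[\cdot,\cdot])$, where $[x,y]=xy-yx$, such that $[R:D]\le f(\varepsilon)$ and $\lvert [D,D]\rvert\le f(\varepsilon)$.
   Context: Rings are associative and not assumed to have an identity element. For a finite ring $R$, the commuting probability is $\mathrm{cp}(R)=\lvert\{(x,y)\in R\times R\mid [x,y]=0\}\rvert/\lvert R\rvert^2$, where $[x,y]=xy-yx$. A Lie-ideal $D$ of $(R,[\cdot,\cdot])$ is an additive subgroup of $R$ with $[d,r]\in D$ for all $d\in D$, $r\in R$. The index $[R:D]$ is the index of $(D,+)$ in $(R,+)$ as additive groups. $[D,D]$ is the additive subgroup of $R$ generated by all $[d_1,d_2]$ with $d_1,d_2\in D$. The function $f$ depends only on $\varepsilon$ and not on $R$. *)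

(* Defs.v *)
From HB Require Import structures.
From mathcomp Require Import all_boot all_order all_fingroup all_algebra.
From mathcomp Require Import reals.

Set Implicit Arguments.
Unset Strict Implicit.
Unset Printing Implicit Defensive.

Import Order.TTheory GRing.Theory Num.Theory.

Local Open Scope ring_scope.

(* The ring structures of ssralg all have an identity element, so rings that
   need not have one are defined here on top of zmodType. *)
HB.mixin Record Zmodule_isRng R of GRing.Zmodule R := {
  rng_mul : R -> R -> R;
  rng_mulA : associative rng_mul;
  rng_mulDl : left_distributive rng_mul +%R;
  rng_mulDr : right_distributive rng_mul +%R
}.

#[short(type="rngType")]
HB.structure Definition Rng := {R of Zmodule_isRng R & GRing.Zmodule R}.

#[short(type="finRngType")]
HB.structure Definition FinRng := {R of Rng R & Finite R}.

(* As for the finite structures of finalg, the group law on R is addition. *)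
HB.instance Definition _ (R : finRngType) := [finGroupMixin of R for +%R].
Coercion FinRng_to_baseFinGroup (R : finRngType) := FinStarMonoid.clone R _.
Coercion FinRng_to_finGroup (R : finRngType) := FinGroup.clone R _.

Definition lie (R : rngType) (x y : R) : R := rng_mul x y - rng_mul y x.

Definition cp (K : realFieldType) (R : finRngType) : K :=
  #|[set xy : R * R | lie xy.1 xy.2 == 0]|%:R / #|R|%:R ^+ 2.

Lemma cp_bounds (K : realFieldType) (R : finRngType) : 0 < cp K R <= 1.
Proof.
have R_gt0 : (0 < #|R|)%N by apply/card_gt0P; exists 0.
have R2_gt0 : 0 < (#|R|%:R : K) ^+ 2 by rewrite exprn_gt0 // ltr0n.
rewrite /cp divr_gt0 //=; last first.
  rewrite ltr0n; apply/card_gt0P; exists (0, 0).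
  by rewrite inE /lie subrr.
rewrite ler_pdivrMr // mul1r -natrX ler_nat -mulnn -card_prod.
exact: max_card.
Qed.

Definition unit_ioc (K : realFieldType) : Type := {e : K | 0 < e <= 1}.

Definition cp_ioc (K : realFieldType) (R : finRngType) : unit_ioc K :=
  exist _ (cp K R) (cp_bounds K R).

(* The type {group R} is that of the additive subgroups of R. *)
Definition lie_ideal (R : finRngType) (D : {group R}) : Prop :=
  forall d r : R, d \in D -> lie d r \in D.

Definition derived_lie (R : finRngType) (D : {group R}) : {set R} :=
  <<[set lie d1 d2 | d1 in D, d2 in D]>>%g.

(* Main.v *)
Require Import Defs.
From mathcomp Require Import all_boot all_order all_fingroup all_algebra.
From mathcomp Require Import reals.

(** Write [x, R] for the additive group of all [x, y]; its order is the index
    of the centralizer of x, so the commuting probability of R is the mean of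
    1 / |[x, R]|.  If it is e and N >= 2 / e, then at least |R| / N elements
    satisfy |[x, R]| <= N: the set X_N of these elements is large
    ([card_small_image]).

    The sets X_M grow with M in a controlled way: X_M + X_M, X_M - X_M and, by
    the Jacobi identity, [X_M, R] all lie in X_(M^2).  Hence, as soon as
    X_(M^2) = X_M, this set is a Lie ideal ([small_image_lie_ideal]).  Such a
    coincidence happens for a bounded M: if x lies in X_(M^4) but not in
    X_(M^2), then X_M and its translate by x are disjoint subsets of X_(M^8),
    so that |X_(M^8)| >= 2 |X_M| ([small_image_double]).  Starting from X_N,
    whose size is at least |R| / N, such doubling cannot take place N times
    in a row ([small_image_stable]).  The resulting ideal D contains X_N, hence
    has index at most N, and |[x, R]| is bounded on D.

    It remains to bound [D, D]; this is the Lie ring analogue of B. H.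
    Neumann's theorem on groups with boundedly finite conjugacy classes
    ([card_derived_lie]).  Choose x in D with V = [x, D] as large as possible,
    and y_v in D with [x, y_v] = v for all v in V.  If c in D commutes with
    every y_v, then [x + c, D] contains V, so is equal to V by maximality, and
    therefore [c, D] lies in V.  Such elements c form a subgroup of bounded
    index in D, and so [D, D] lies in the sum of [x, R] and of the groups
    [t, R] for t in a bounded set of coset representatives. *)

Set Implicit Arguments.
Unset Strict Implicit.
Unset Printing Implicit Defensive.

Import Order.TTheory GRing.Theory Num.Theory.

Local Open Scope ring_scope.

(** * Commutators in a ring without identity *)

Section LieRing.

Variable R : rngType.
Implicit Types x y z : R.

Lemma rng_mul0l x : rng_mul 0 x = 0.
Proof. by apply: (addIr (rng_mul 0 x)); rewrite -rng_mulDl !add0r. Qed.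

Lemma rng_mul0r x : rng_mul x 0 = 0.
Proof. by apply: (addIr (rng_mul x 0)); rewrite -rng_mulDr !add0r. Qed.

Lemma rng_mulNl x y : rng_mul (- x) y = - rng_mul x y.
Proof. by apply/eqP; rewrite -addr_eq0 -rng_mulDl addNr rng_mul0l. Qed.

Lemma rng_mulNr x y : rng_mul x (- y) = - rng_mul x y.
Proof. by apply/eqP; rewrite -addr_eq0 -rng_mulDr addNr rng_mul0r. Qed.

Lemma lieDl x y z : lie (x + y) z = lie x z + lie y z.
Proof. by rewrite /lie rng_mulDl rng_mulDr opprD addrACA. Qed.

Lemma lieDr x y z : lie x (y + z) = lie x y + lie x z.
Proof. by rewrite /lie rng_mulDl rng_mulDr opprD addrACA. Qed.

Lemma lieNl x y : lie (- x) y = - lie x y.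
Proof. by rewrite /lie rng_mulNl rng_mulNr opprB opprK addrC. Qed.

Lemma lieNr x y : lie x (- y) = - lie x y.
Proof. by rewrite /lie rng_mulNl rng_mulNr opprB opprK addrC. Qed.

Lemma lieC x y : lie x y = - lie y x.
Proof. by rewrite /lie opprB. Qed.

Lemma lie0l x : lie 0 x = 0.
Proof. by rewrite /lie rng_mul0l rng_mul0r subrr. Qed.

Lemma lie0r x : lie x 0 = 0.
Proof. by rewrite /lie rng_mul0l rng_mul0r subrr. Qed.

Lemma lieBl x y z : lie (x - y) z = lie x z - lie y z.
Proof. by rewrite lieDl lieNl. Qed.

Lemma lieBr x y z : lie x (y - z) = lie x y - lie x z.
Proof. by rewrite lieDr lieNr. Qed.

Lemma lie_jacobi x y z : lie (lie x y) z = lie x (lie y z) - lie y (lie x z).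
Proof.
rewrite /lie !(rng_mulDl, rng_mulDr, rng_mulNl, rng_mulNr) !rng_mulA.
rewrite !opprD !opprK.
set a := rng_mul (rng_mul x y) z; set b := rng_mul (rng_mul y x) z.
set c := rng_mul (rng_mul z x) y; set d := rng_mul (rng_mul z y) x.
set e := rng_mul (rng_mul x z) y; set g := rng_mul (rng_mul y z) x.
rewrite [RHS](AC ((2*2)*(2*2)) ((1*5)*(8*4)*(7*2)*(6*3))).
by rewrite /= !subrr !addr0.
Qed.

End LieRing.


(** * Finite sets *)

(** A choice of preimages in A for the elements of the image of A; the default
    x0 is only taken outside that image. *)
Lemma exists_section (aT rT : finType) (x0 : aT) (f : aT -> rT) (A : {set aT}) :
  exists g : rT -> aT,
    forall a, a \in A -> g (f a) \in A /\ f (g (f a)) = f a.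
Proof.
exists (fun b => odflt x0 [pick a in A | f a == b]) => a Aa.
case: pickP => [c /andP[Ac /eqP fc] | /(_ a)]; first by split.
by rewrite /= Aa eqxx.
Qed.

Lemma leq_card_pfamily (aT rT : finType) (y0 : rT) (A : {set aT})
    (F : aT -> {set rT}) M :
  (forall a, a \in A -> #|F a| <= M)%N ->
  (#|pfamily y0 (mem A) (fun a => mem (F a))| <= M ^ #|A|)%N.
Proof.
move=> leFM; rewrite card_pfamily cardE.
have: {subset enum A <= A} by move=> a; rewrite mem_enum.
rewrite /image_mem; elim: (enum _) => //= a s IHs sA.
rewrite expnS leq_mul ?IHs //; first by apply/leFM/sA/mem_head.
by move=> b sb; apply: sA; rewrite inE sb orbT.
Qed.

(** * Elements with a small set of commutators *)

Section FiniteLieRing.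

Variable R : finRngType.
Implicit Types (x y z : R) (N M : nat) (D : {group R}).

Definition lie_image x : {set R} := [set lie x y | y in [set: R]].

Lemma mem_lie_image x y : lie x y \in lie_image x.
Proof. exact/imset_f/in_setT. Qed.

Lemma lie_image_group_set x : group_set (lie_image x).
Proof.
apply/group_setP; split; first by rewrite -[1%g](lie0r x) mem_lie_image.
move=> _ _ /imsetP[y _ ->] /imsetP[z _ ->].
by rewrite -[(_ * _)%g]lieDr mem_lie_image.
Qed.
Canonical lie_image_group x := group (lie_image_group_set x).

Lemma card_lie_image_cent x :
  (#|lie_image x| * #|[set y | lie x y == 0%R]| = #|R|)%N.
Proof.
have lieM : {in [set: R] &, {morph lie x : y z / (y * z)%g}}.
  by move=> y z _ _; apply: lieDr.
pose f := Morphism lieM.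
have -> : lie_image x = (f @* [set: R])%g by rewrite morphimEdom.
have -> : [set y | lie x y == 0] = ('ker f)%g.
  by apply/setP=> y; rewrite !inE.
by rewrite card_morphim setIid mulnC Lagrange ?cardsT // subsetT.
Qed.

Lemma card_lie_imageN x : #|lie_image (- x)| = #|lie_image x|.
Proof.
suff -> : lie_image (- x) = lie_image x by [].
apply/setP=> v; apply/imsetP/imsetP=> -[y _ ->]; exists (- y) => //.
  by rewrite lieNl lieNr.
by rewrite lieNl lieNr opprK.
Qed.

Lemma card_lie_imageD x y :
  (#|lie_image (x + y)%R| <= #|lie_image x| * #|lie_image y|)%N.
Proof.
rewrite mul_cardG; apply: leq_trans (leq_pmulr _ (cardG_gt0 _)).
apply/subset_leq_card/subsetP=> _ /imsetP[z _ ->].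
by rewrite lieDl; apply: (@mem_mulg R); apply: mem_lie_image.
Qed.

(** By the Jacobi identity, [[x, y], z] = [x, [y, z]] - [y, [x, z]], where the
    first term ranges over [x, R] and the second over the image of [x, R] by
    the map [y, -]. *)
Lemma card_lie_image_lie x y :
  (#|lie_image (lie x y)| <= #|lie_image x| ^ 2)%N.
Proof.
pose S := [set u - lie y v | u in lie_image x, v in lie_image x].
have sub : lie_image (lie x y) \subset S.
  apply/subsetP=> _ /imsetP[z _ ->]; rewrite lie_jacobi.
  by apply: imset2_f; apply: mem_lie_image.
apply: leq_trans (subset_leq_card sub) _.
by rewrite /S curry_imset2X (leq_trans (leq_imset_card _ _)) // cardsX mulnn.
Qed.

Definition small_image N : {set R} := [set x | #|lie_image x| <= N]%N.

Lemma small_imageS M N : (M <= N)%N -> small_image M \subset small_image N.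
Proof.
by move=> leMN; apply/subsetP=> x; rewrite !inE => /leq_trans->.
Qed.

Lemma small_imageN N x : x \in small_image N -> - x \in small_image N.
Proof. by rewrite !inE card_lie_imageN. Qed.

Lemma small_imageD M N x y :
  x \in small_image M -> y \in small_image N -> x + y \in small_image (M * N).
Proof.
by rewrite !inE => sx sy; rewrite (leq_trans (card_lie_imageD x y)) ?leq_mul.
Qed.

Lemma small_image_lie N x y :
  x \in small_image N -> lie x y \in small_image (N ^ 2).
Proof.
by rewrite !inE => sx; rewrite (leq_trans (card_lie_image_lie x y)) ?leq_sqr.
Qed.

(** The number of commuting pairs is the sum of the orders of the centralizers;
    each of those is less than |R| / N outside small_image N, so these elements
    contribute at most half of the pairs, and at most |R| pairs come from each
    of the others. *)
Lemma card_small_image N :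
  (2 * #|R| ^ 2 <= N * #|[set xy : R * R | lie xy.1 xy.2 == 0%R]| ->
   #|R| <= N * #|small_image N|)%N.
Proof.
have -> : #|[set xy : R * R | lie xy.1 xy.2 == 0%R]| =
          (\sum_(x : R) #|[set y : R | lie x y == 0%R]|)%N.
  rewrite (eq_bigr (fun x : R => \sum_(y : R | lie x y == 0%R) 1)%N) => [|x _].
    rewrite pair_big_dep /= -sum1_card; apply: eq_bigl => xy.
    by rewrite inE.
  by rewrite -sum1_card; apply: eq_bigl => y; rewrite inE.
have Rgt0 : (0 < #|R|)%N by apply/card_gt0P; exists 0.
move=> le2; rewrite -(leq_pmul2r Rgt0) -(leq_add2r (#|R| ^ 2)).
rewrite mulnn addnn -mul2n (leq_trans le2) // big_distrr /=.
have -> : (N * #|small_image N| * #|R| + #|R| ^ 2 =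
           \sum_x ((x \in small_image N) * (N * #|R|) + #|R|))%N.
  rewrite big_split /= sum_nat_const -[in RHS]big_distrl /=.
  rewrite -mulnn mulnAC; congr (_ + _)%N; rewrite mulnC; congr (_ * _)%N.
  by rewrite -sum1_card big_mkcond; apply: eq_bigr => x _; case: (_ \in _).
apply: leq_sum => x _; case: (boolP (x \in small_image N)) => [_ | ].
  rewrite mul1n (leq_trans _ (leq_addr _ _)) // leq_mul //.
  exact: max_card.
rewrite inE -ltnNge => ltN; rewrite mul0n add0n -(card_lie_image_cent x).
by rewrite leq_mul // ltnW.
Qed.

(** An element x of the difference of the two sets translates small_image M
    to a disjoint set: from x + a = b would follow that x = b - a lies in
    small_image (M ^ 2).  With the exponents 2 and 4, equality
    of the two sets has the form small_image (L ^ 2) = small_image L. *)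
Lemma small_image_double M : (0 < M)%N ->
    small_image (M ^ 2) != small_image (M ^ 4) ->
  (2 * #|small_image M| <= #|small_image (M ^ 8)|)%N.
Proof.
move=> Mgt0; rewrite eqEsubset small_imageS ?leq_pexp2l //=.
case/subsetPn=> x x4 x2.
pose xA := [set x + a | a in small_image M].
have cxA : #|xA| = #|small_image M| by apply/card_imset/addrI.
rewrite mul2n -addnn -{2}cxA -cardsUI.
have -> : small_image M :&: xA = set0.
  apply/setP=> b; rewrite in_setI in_set0; apply/negP=> /andP[Mb].
  case/imsetP=> a Ma defb; case/negP: x2.
  by rewrite -(addrK a x) -defb -mulnn small_imageD ?small_imageN.
rewrite cards0 addn0; apply: subset_leq_card; rewrite subUset.
rewrite small_imageS ?(leq_pexp2l _ (_ : 1 <= 8)%N) //=.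
apply/subsetP=> _ /imsetP[a Ma ->].
apply: (subsetP (small_imageS _)) (small_imageD x4 Ma).
by rewrite -expnSr leq_pexp2l.
Qed.

(** Otherwise the size at least doubles each time that the parameter is raised
    to the power 8, and N steps give 2 ^ N > N times the initial size, which is
    more than |R|. *)
Lemma small_image_stable N : (0 < N)%N -> (#|R| <= N * #|small_image N|)%N ->
  exists2 k, (k < N)%N &
    small_image ((N ^ (8 ^ k)) ^ 2) = small_image ((N ^ (8 ^ k)) ^ 4).
Proof.
move=> Ngt0 leR.
have [/existsP[k /eqP eqk] | /existsPn neq] := boolP [exists k : 'I_N,
  small_image ((N ^ (8 ^ k)) ^ 2) == small_image ((N ^ (8 ^ k)) ^ 4)].
  by exists k.
have grow k : (k <= N)%N ->
    (2 ^ k * #|small_image N| <= #|small_image (N ^ (8 ^ k))|)%N.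
  elim: k => [|k IHk] ltkN; first by rewrite mul1n.
  rewrite expnS -mulnA.
  rewrite (leq_trans _ (_ : 2 * #|small_image (N ^ (8 ^ k))| <= _)%N) //.
    by rewrite leq_mul2l IHk // ltnW.
  rewrite [(8 ^ _.+1)%N]expnSr expnM small_image_double ?expn_gt0 ?Ngt0 //.
  exact: neq (Ordinal ltkN).
have Agt0 : (0 < #|small_image N|)%N.
  rewrite -(ltn_pmul2l Ngt0) muln0 (leq_trans _ leR) //.
  by apply/card_gt0P; exists 0.
have := leq_trans (grow N (leqnn N)) (leq_trans (max_card _) leR).
by rewrite leq_pmul2r // leqNgt ltn_expl.
Qed.

(** All the operations that a Lie ideal has to be closed under send
    small_image N to small_image (N ^ 2). *)
Lemma small_image_lie_ideal N : small_image N = small_image (N ^ 2) ->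
  (0 < N)%N -> exists2 D, lie_ideal D & D = small_image N :> {set R}.
Proof.
move=> eqN Ngt0; have gN : group_set (small_image N).
  apply/group_setP; split.
    rewrite inE (leq_trans _ Ngt0) // -(cards1 (0 : R)) subset_leq_card //.
    by apply/subsetP=> _ /imsetP[y _ ->]; rewrite inE; apply/eqP/lie0l.
  by move=> x y sx sy; rewrite eqN -mulnn; apply: small_imageD.
exists (group gN) => // d r /= Dd.
by rewrite eqN; apply: small_image_lie.
Qed.

(** * Boundedness of the derived ring *)

Lemma leq_card_joing (A B : {group R}) : (#|A <*> B|%g <= #|A| * #|B|)%N.
Proof.
rewrite comm_joingE ?mul_cardG ?leq_pmulr ?cardG_gt0 //.
by apply: centC; apply/centsP=> x _ y _; apply: addrC.
Qed.

Lemma small_group_of_lie_images M (s : seq R) :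
    (forall t, t \in s -> #|lie_image t| <= M)%N ->
  exists2 S : {group R}, forall t, t \in s -> lie_image t \subset S
                       & (#|S| <= M ^ size s)%N.
Proof.
elim: s => [|t s IHs] leM; first by exists 1%G; rewrite ?cards1.
case: IHs => [u su | S sS cS]; first by rewrite leM // inE su orbT.
exists (lie_image_group t <*> S)%G => [u|] /=; last first.
  rewrite (leq_trans (leq_card_joing _ _)) // expnS leq_mul //.
  exact/leM/mem_head.
rewrite inE => /predU1P[-> | /sS sub]; first exact: joing_subl.
exact: subset_trans sub (joing_subr _ _).
Qed.

(** Neumann's argument.  The bound comes from the element x with the largest
    image, together with at most M ^ M representatives of the cosets of the
    common centralizer of the y_v, each of which contributes a factor M. *)
Lemma card_derived_lie M D : (forall x, x \in D -> #|lie_image x| <= M)%N ->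
  (#|derived_lie D| <= M ^ (M ^ M).+1)%N.
Proof.
move=> leM.
have Mgt0 : (0 < M)%N.
  exact: leq_trans (cardG_gt0 (lie_image_group 1%g)) (leM _ (group1 D)).
have [x Dx maxx] : exists2 x, x \in D &
    forall z, z \in D -> (#|lie z @: D| <= #|lie x @: D|)%N.
  by case: (arg_maxnP (fun z => #|lie z @: D|) (group1 D)) => x; exists x.
set V := lie x @: D in maxx.
have cV : (#|V| <= M)%N.
  apply: leq_trans (leM _ Dx); apply/subset_leq_card/imsetS/subsetP=> y _.
  exact: in_setT.
have [y Hy] := exists_section 0 (lie x) D.
have yP v : v \in V -> y v \in D /\ lie x (y v) = v.
  by case/imsetP=> d Dd ->; apply: Hy.
(* Adding c to x preserves the values on the y_v, so the image, being of
   maximal size, cannot change. *)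
have cent_sub c d :
    c \in D -> d \in D -> (forall v, v \in V -> lie c (y v) = 0) ->
  lie c d \in lie_image x.
  move=> Dc Dd c0.
  have sVc : V \subset lie (x + c) @: D.
    apply/subsetP=> v Vv; have [Dy defv] := yP v Vv.
    by apply/imsetP; exists (y v) => //; rewrite lieDl defv c0 ?addr0.
  have defV : lie (x + c) @: D = V.
    by apply/esym/eqP; rewrite eqEcard sVc maxx //; apply: groupM Dx Dc.
  have: lie (x + c) d \in V by rewrite -defV imset_f.
  case/imsetP=> d' _; rewrite lieDl => /(canRL (addKr _)) ->.
  by rewrite addrC -lieBr mem_lie_image.
(* The fibres of phi on D are the cosets of the common centralizer in D of the
   y_v, so counting the values of phi bounds its index. *)
pose phi d : {ffun R -> R} := [ffun v => if v \in V then lie d (y v) else 0].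
have cW : (#|phi @: D| <= M ^ M)%N.
  have le1 : (M ^ #|V| <= M ^ M)%N by rewrite leq_pexp2l.
  pose F v := lie_image (y v).
  have leF v : v \in V -> (#|F v| <= M)%N by case/yP=> /leM.
  apply: leq_trans (leq_trans (leq_card_pfamily 0 leF) le1).
  apply/subset_leq_card/subsetP=> _ /imsetP[d Dd ->].
  apply/pfamilyP; split=> [|v Vv].
    by apply/supportP=> v /negPf nVv; rewrite ffunE nVv.
  by rewrite ffunE Vv lieC -lieNr; apply: mem_lie_image.
have [rep repP] := exists_section 0 phi D.
pose reps := [seq rep w | w <- enum (phi @: D)].
have [|S sS cS] := @small_group_of_lie_images M (x :: reps).
  move=> t; rewrite inE => /predU1P[-> | /mapP[w]]; first exact: leM.
  by rewrite mem_enum => /imsetP[d Dd ->] ->; apply: leM; case: (repP d Dd).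
have subS : derived_lie D \subset S.
  rewrite gen_subG; apply/subsetP=> _ /imset2P[d d' Dd Dd' ->].
  have [Dt eqt] := repP d Dd; set t := rep _ in Dt eqt.
  rewrite -(subrK t d) lieDl; apply: groupM.
    apply: (subsetP (sS x (mem_head _ _))); apply: cent_sub => //.
      exact: groupM Dd (groupVr Dt).
    move=> v Vv; move/ffunP/(_ v): eqt; rewrite !ffunE Vv => eqt.
    by rewrite lieBl eqt subrr.
  apply: (subsetP (sS t _)); last exact: mem_lie_image.
  by rewrite inE map_f ?orbT // mem_enum imset_f.
apply: leq_trans (subset_leq_card subS) (leq_trans cS _).
by rewrite /= size_map -cardE leq_pexp2l.
Qed.

End FiniteLieRing.

Theorem corollary1p2 (K : realType) :
  exists f : unit_ioc K -> nat,
    forall R : finRngType,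
      exists D : {group R},
        [/\ lie_ideal D,
            (#|[set: R] : D|%g <= f (cp_ioc K R))%N
          & (#|derived_lie D| <= f (cp_ioc K R))%N].
Proof.
pose bnd (e : unit_ioc K) := Num.bound (2 / sval e).
(* An upper bound for (n ^ (8 ^ k)) ^ 2 that is valid for all k < n. *)
pose big n := (n ^ (2 * 8 ^ n))%N.
exists (fun e => bnd e + big (bnd e) ^ (big (bnd e) ^ big (bnd e)).+1)%N => R.
set N := bnd _; set L := big N.
have /andP[cp_gt0 _] := cp_bounds K R.
have ltN : 2 / cp K R < N%:R by apply: archi_boundP; rewrite divr_ge0 ?ltW.
have Ngt0 : (0 < N)%N.
  by rewrite -(ltr0n K) (le_lt_trans _ ltN) // divr_ge0 ?ltW.
have Rgt0 : (0 < #|R|)%N by apply/card_gt0P; exists 0.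
have leR : (#|R| <= N * #|small_image R N|)%N.
  apply: card_small_image; rewrite -(ler_nat K) natrM natrX natrM.
  move: ltN; rewrite ltr_pdivrMr // /cp mulrA ltr_pdivlMr.
    by move/ltW.
  by rewrite exprn_gt0 ?ltr0n.
have [k ltkN eqk] := small_image_stable Ngt0 leR.
set M := (N ^ _)%N in eqk.
have Mgt0 : (0 < M)%N by rewrite expn_gt0 Ngt0.
have [||D idD defD] := @small_image_lie_ideal R (M ^ 2).
- by rewrite -expnM.
- by rewrite expn_gt0 Mgt0.
have leM2L : (M ^ 2 <= L)%N.
  by rewrite -expnM mulnC leq_pexp2l // leq_mul2l /= leq_pexp2l // ltnW.
exists D; split=> //.
  apply: leq_trans (leq_addr _ _); rewrite -(leq_pmul2l (cardG_gt0 D)).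
  rewrite Lagrange ?subsetT // cardsT (leq_trans leR) // mulnC leq_mul2r.
  rewrite defD subset_leq_card ?orbT // small_imageS //.
  by rewrite -expnM -{1}(expn1 N) leq_pexp2l // muln_gt0 expn_gt0.
apply: leq_trans (leq_addl _ _); apply: card_derived_lie => x.
by rewrite defD inE => /leq_trans->.
Qed.
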